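(* Let $S\subset\mathbb{R}^n$ be a nonempty closed set satisfying the extended exterior $r(\cdot)$-sphere condition for some continuous function $r(\cdot)\colon\operatorname{bdry}S\to\,]0,+\infty]$. Define $\rho\colon S^c\to\,]0,+\infty]$ by $\rho(x):=\min\{r(s)/2 : s\in\operatorname{proj}_S(x)\}$, and for $\gamma>0$ define $\varrho_\gamma\colon S^c\to\,]0,+\infty]$ by $$\varrho_\gamma(x):=\max\Big\{\gamma\, d_S(x),\ \tfrac12\sqrt{\gamma^2 d_S(x)^2+4\rho(x)^2}\Big\}.$$ Then for every $\gamma$ with $\frac{1}{2\sqrt3-2}\le\gamma<1$, the function $\varrho_\gamma$ is lower semicontinuous and $S^c$ is the union of closed balls with radius function $\varrho_\gamma(\cdot)$.
   Context: Notation: $S^c$, $\operatorname{int}S$, $\operatorname{bdry}S$ denote complement, interior and boundary; $d_S(x)$ is the Euclidean distance from $x$ to $S$ and $\operatorname{proj}_S(x)=\{s\in S: \|s-x\|=d_S(x)\}$. $B(z;\delta)$ and $\bar B(z;\delta)$ are the open and closed balls of center $z$ and radius $\delta$. Values $+\infty$ are handled with the usual conventions (so $\rho(x)=+\infty$ gives $\varrho_\gamma(x)=+\infty$). Proximal normal cone: for $s\in S$, $N^P_S(s)$ is the set of $\zeta\in\mathbb{R}^n$ for which there is $\sigma\ge0$ with $\langle\zeta,x-s\rangle\le\sigma\|x-s\|^2$ for all $x\in S$. A unit vector $\zeta\in N^P_S(s)$ is said to be realized by a $\rho$-sphere ($\rho>0$) if $B(s+\rho\zeta;\rho)\cap S=\emptyset$,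 equivalently $\langle\zeta,x-s\rangle\le\frac{1}{2\rho}\|x-s\|^2$ for all $x\in S$. Extended exterior $r(\cdot)$-sphere condition: for every $s\in\operatorname{bdry}S$: (a) if $s\in\operatorname{bdry}(\operatorname{int}S)$, there exists a unit vector $\zeta_s\in N^P_S(s)$ that is realized by an $r(s)$-sphere when $r(s)<+\infty$, and realized by a $\rho$-sphere for every $\rho>0$ (i.e. $\langle\zeta_s,x-s\rangle\le0$ for all $x\in S$) when $r(s)=+\infty$; (b) if $s\notin\operatorname{bdry}(\operatorname{int}S)$, then every unit vector $\zeta_s\in N^P_S(s)$ has this property. Union of closed balls: a nonempty open set $\mathcal{O}$ is the union of closed balls with lower semicontinuous radius function $\varrho\colon\mathcal{O}\to\,]0,+\infty]$ if for every $x\in\mathcal{O}$ there exists $y_x\in\mathcal{O}$ such that $x\in\bar B(y_x;\varrho(x))\subset\mathcal{O}$ if $\varrho(x)<+\infty$, and $x\in\bar B(x+\delta(y_x-x);\delta)\subset\mathcal{O}$ for all $\delta>0$ if $\varrho(x)=+\infty$. *)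

(* Defs.v *)
(* R : realType, points of R^n are row vectors 'rV[R]_n,
   with the EUCLIDEAN inner product and norm defined below (the library's
   norm on 'rV is the max-norm, so we define the Euclidean one explicitly). *)
From HB Require Import structures.
From mathcomp Require Import all_boot all_order all_algebra.
From mathcomp Require Import all_classical all_reals.
From mathcomp Require Import ereal.
Set Implicit Arguments. Unset Strict Implicit. Unset Printing Implicit Defensive.
Import Order.TTheory GRing.Theory Num.Theory.
Local Open Scope classical_set_scope.
Local Open Scope ring_scope.

Section Euclid.
Variables (R : realType) (n : nat).
Notation V := 'rV[R]_n.

Definition dotp (x y : V) : R := \sum_(i < n) x ord0 i * y ord0 i.
Definition enorm (x : V) : R := Num.sqrt (dotp x x).

Definition oball (z : V) (d : R) : set V := [set x | enorm (x - z) < d].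
Definition cball (z : V) (d : R) : set V := [set x | enorm (x - z) <= d].

Definition eclosure (A : set V) : set V :=
  [set x | forall e : R, 0 < e -> exists2 y, A y & enorm (y - x) < e].
Definition einterior (A : set V) : set V :=
  [set x | exists2 e : R, 0 < e & oball x e `<=` A].
Definition eclosed (A : set V) : Prop := eclosure A `<=` A.
Definition eopen (A : set V) : Prop := A `<=` einterior A.
Definition bdry (A : set V) : set V := eclosure A `\` einterior A.

Definition dist (S : set V) (x : V) : R := inf [set enorm (x - s) | s in S].
Definition proj (S : set V) (x : V) : set V :=
  [set s | S s /\ enorm (s - x) = dist S x].

Definition prox_normal (S : set V) (s : V) : set V :=
  [set z | exists2 sigma : R, 0 <= sigma &
     forall x, S x -> dotp z (x - s) <= sigma * (enorm (x - s)) ^+ 2].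

Definition realized (S : set V) (s z : V) (rho : R) : Prop :=
  oball (s + rho *: z) rho `&` S = set0.

Definition realized_ext (S : set V) (s z : V) (r : \bar R) : Prop :=
  match r with
  | EFin rho => realized S s z rho
  | +oo%E => forall rho : R, 0 < rho -> realized S s z rho
  | -oo%E => False
  end.

Definition ext_ext_sphere (S : set V) (r : V -> \bar R) : Prop :=
  forall s, bdry S s ->
    (bdry (einterior S) s ->
       exists z, [/\ enorm z = 1, prox_normal S s z & realized_ext S s z (r s)]) /\
    (~ bdry (einterior S) s ->
       forall z, enorm z = 1 -> prox_normal S s z -> realized_ext S s z (r s)).

(* continuity of an extended-real valued function on A, for the
   (order) topology of \bar R *)
Definition econt_on (A : set V) (f : V -> \bar R) : Prop :=
  forall x, A x ->
    (forall t : R, (t%:E < f x)%E -> exists2 d : R, 0 < d &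
        forall y, A y -> enorm (y - x) < d -> (t%:E < f y)%E) /\
    (forall t : R, (f x < t%:E)%E -> exists2 d : R, 0 < d &
        forall y, A y -> enorm (y - x) < d -> (f y < t%:E)%E).

Definition elsc_on (A : set V) (f : V -> \bar R) : Prop :=
  forall x, A x ->
    forall t : R, (t%:E < f x)%E -> exists2 d : R, 0 < d &
        forall y, A y -> enorm (y - x) < d -> (t%:E < f y)%E.

(* rho(x) = min { r(s)/2 : s in proj_S(x) } (the min is attained) *)
Definition rho_fun (S : set V) (r : V -> \bar R) (x : V) : \bar R :=
  ereal_inf [set (r s * (2^-1)%:E)%E | s in proj S x].

Definition varrho (S : set V) (r : V -> \bar R) (gamma : R) (x : V) : \bar R :=
  match rho_fun S r x with
  | EFin p => (Num.max (gamma * dist S x)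
                 (2^-1 * Num.sqrt (gamma ^+ 2 * (dist S x) ^+ 2 + 4 * p ^+ 2)))%:E
  | +oo%E => +oo%E
  | -oo%E => (gamma * dist S x)%:E
  end.

Definition union_closed_balls (O : set V) (vr : V -> \bar R) : Prop :=
  forall x, O x -> exists2 y, O y &
    (forall p : R, vr x = p%:E -> cball y p x /\ cball y p `<=` O) /\
    (vr x = +oo%E ->
       forall d : R, 0 < d -> cball (x + d *: (y - x)) d x /\
                              cball (x + d *: (y - x)) d `<=` O).

End Euclid.

(* Main.v *)
(** Let s be a projection of x on S and d the distance from x to S.  There is a
    unit normal z at s that is realized by an r(s)-sphere and makes an angle of
    at most pi/2 with x - s: off the boundary of the interior, z = (x - s)/d will
    do, and otherwise z is a limit of normals at the points where segments that
    start in the interior of S near s and run towards x leave that interior.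
    The open balls centred on the segment from x to s + 2 rho(x) z that have s on
    their boundary all avoid S, and the required closed ball is found inside one
    of them.  If rho(x) is infinite, S lies in a half-space that the balls
    of radius delta centred at x + delta z can meet only at x.

    The lower semicontinuity reduces to that of rho, by compactness of
    minimizing sequences, since the radius is a nondecreasing and positively
    homogeneous function of (gamma d, rho). *)

From HB Require Import structures.
From mathcomp Require Import all_boot all_order all_algebra.
From mathcomp Require Import all_classical all_reals.
From mathcomp Require Import ereal topology normedtype ring lra.
Require Import Defs.
Set Implicit Arguments. Unset Strict Implicit. Unset Printing Implicit Defensive.
Import Order.TTheory GRing.Theory Num.Theory.
Import numFieldNormedType.Exports.
Local Open Scope classical_set_scope.
Local Open Scope ring_scope.

(** * Euclidean inner product, norm and compactness *)

Lemma dotpC (R : realType) n (x y : 'rV[R]_n) : dotp x y = dotp y x.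
Proof. by apply: eq_bigr => i _; rewrite mulrC. Qed.

Lemma dotpDl (R : realType) n (x y z : 'rV[R]_n) :
  dotp (x + y) z = dotp x z + dotp y z.
Proof. by rewrite -big_split; apply: eq_bigr => i _; rewrite mxE mulrDl. Qed.

Lemma dotpZl (R : realType) n a (x y : 'rV[R]_n) :
  dotp (a *: x) y = a * dotp x y.
Proof. by rewrite mulr_sumr; apply: eq_bigr => i _; rewrite mxE mulrA. Qed.

Lemma dotpNl (R : realType) n (x y : 'rV[R]_n) : dotp (- x) y = - dotp x y.
Proof. by rewrite -scaleN1r dotpZl mulN1r. Qed.

Lemma dotpDr (R : realType) n (x y z : 'rV[R]_n) :
  dotp z (x + y) = dotp z x + dotp z y.
Proof. by rewrite !(dotpC z) dotpDl. Qed.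

Lemma dotpZr (R : realType) n a (x y : 'rV[R]_n) :
  dotp y (a *: x) = a * dotp y x.
Proof. by rewrite !(dotpC y) dotpZl. Qed.

Lemma dotpNr (R : realType) n (x y : 'rV[R]_n) : dotp y (- x) = - dotp y x.
Proof. by rewrite !(dotpC y) dotpNl. Qed.

Definition dotpE := (dotpDl, dotpDr, dotpNl, dotpNr, dotpZl, dotpZr).

Lemma dotp_ge0 (R : realType) n (x : 'rV[R]_n) : 0 <= dotp x x.
Proof. by apply: sumr_ge0 => i _; rewrite -expr2 sqr_ge0. Qed.

Lemma enorm_ge0 (R : realType) n (x : 'rV[R]_n) : 0 <= enorm x.
Proof. exact: sqrtr_ge0. Qed.

Lemma enorm_sqr (R : realType) n (x : 'rV[R]_n) : enorm x ^+ 2 = dotp x x.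
Proof. by rewrite sqr_sqrtr // dotp_ge0. Qed.

Lemma enormN (R : realType) n (x : 'rV[R]_n) : enorm (- x) = enorm x.
Proof. by rewrite /enorm !dotpE opprK. Qed.

Lemma enormB (R : realType) n (x y : 'rV[R]_n) : enorm (x - y) = enorm (y - x).
Proof. by rewrite -enormN opprB. Qed.

Lemma enormZ (R : realType) n a (x : 'rV[R]_n) :
  enorm (a *: x) = `|a| * enorm x.
Proof.
by rewrite /enorm !dotpE mulrA -expr2 sqrtrM ?sqr_ge0// sqrtr_sqr.
Qed.

Lemma enorm0 (R : realType) n : enorm (0 : 'rV[R]_n) = 0.
Proof. by rewrite -(scale0r 0) enormZ normr0 mul0r. Qed.

Lemma enorm_eq0 (R : realType) n (x : 'rV[R]_n) : enorm x = 0 -> x = 0.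
Proof.
move=> x0; have := enorm_sqr x; rewrite x0 expr0n /= => /esym/eqP.
rewrite psumr_eq0; last by move=> i _; rewrite -expr2 sqr_ge0.
move/allP => xi0; apply/rowP => i; rewrite mxE.
by have := xi0 i (mem_index_enum i); rewrite -expr2 sqrf_eq0 => /eqP.
Qed.

Lemma enorm_le (R : realType) n (x : 'rV[R]_n) a :
  0 <= a -> (enorm x <= a) = (dotp x x <= a ^+ 2).
Proof. by move=> a0; rewrite -enorm_sqr ler_pXn2r ?nnegrE ?enorm_ge0. Qed.

Lemma enorm_lt (R : realType) n (x : 'rV[R]_n) a :
  0 <= a -> (enorm x < a) = (dotp x x < a ^+ 2).
Proof. by move=> a0; rewrite -enorm_sqr ltr_pXn2r ?nnegrE ?enorm_ge0. Qed.

Lemma dotp_le_enorm (R : realType) n (x y : 'rV[R]_n) :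
  dotp x y <= enorm x * enorm y.
Proof.
have [/enorm_eq0->|x0] := eqVneq (enorm x) 0.
  by rewrite -(scale0r 0) dotpZl enormZ normr0 !mul0r.
have [/enorm_eq0->|y0] := eqVneq (enorm y) 0.
  by rewrite -(scale0r 0) dotpZr enormZ normr0 !mul0r mulr0.
have xp : 0 < enorm x by rewrite lt_def x0 enorm_ge0.
have yp : 0 < enorm y by rewrite lt_def y0 enorm_ge0.
have := dotp_ge0 (enorm y *: x - enorm x *: y).
rewrite !dotpE (dotpC y x) -!enorm_sqr => h.
have xyp := mulr_gt0 xp yp.
rewrite -(ler_pM2l xyp); lra.
Qed.

Lemma enormD (R : realType) n (x y : 'rV[R]_n) :
  enorm (x + y) <= enorm x + enorm y.
Proof.
rewrite enorm_le ?addr_ge0 ?enorm_ge0//.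
rewrite !dotpE (dotpC y x) -!enorm_sqr; have := dotp_le_enorm x y; lra.
Qed.

Lemma enorm_triangle (R : realType) n (y x z : 'rV[R]_n) :
  enorm (x - z) <= enorm (x - y) + enorm (y - z).
Proof. by rewrite -{1}(subrK y x) -addrA enormD. Qed.

Lemma normr_coord_le_enorm (R : realType) n (x : 'rV[R]_n) i :
  `|x ord0 i| <= enorm x.
Proof.
rewrite -ler_sqr ?nnegrE ?enorm_ge0// enorm_sqr real_normK ?num_real//.
rewrite /dotp (bigD1 i)//= -expr2 lerDl.
by apply: sumr_ge0 => j _; rewrite -expr2 sqr_ge0.
Qed.

Lemma enorm_le_coord (R : realType) n (x : 'rV[R]_n) a :
  (forall i, `|x ord0 i| <= a) -> 0 <= a -> enorm x <= n%:R * a.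
Proof.
move=> xa a0; rewrite enorm_le ?mulr_ge0//.
have : dotp x x <= n%:R * a ^+ 2.
  rewrite /dotp mulr_natl -[X in _ *+ X]card_ord -sumr_const ler_sum// => i _.
  by rewrite -expr2 -real_normK ?num_real// ler_sqr ?nnegrE.
move/le_trans; apply; rewrite exprMn ler_wpM2r ?sqr_ge0//.
by rewrite -natrX ler_nat; case: (n) => // m; rewrite expnS leq_pmulr// expn_gt0.
Qed.

(** A bounded sequence stays in a cube, which is compact in the product topology; comparison with
    the coordinates turns a cluster point there into one for the Euclidean norm. *)
Lemma bounded_enorm_cluster (R : realType) n (u : nat -> 'rV[R]_n) M :
  (forall i, enorm (u i) <= M) ->
  exists l, forall e, 0 < e -> forall N, exists2 i, (N <= i)%N &
    enorm (u i - l) < e.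
Proof.
move=> uM.
have uK : (u @ \oo) [set v | forall j, `[- M, M]%classic (v ord0 j)].
  exists 0 => // i _ j /=; rewrite in_itv /= -ler_norml.
  exact: le_trans (normr_coord_le_enorm _ _) (uM i).
have [l [_ ul]] := rV_compact (fun=> @segment_compact R _ _) _ uK.
exists l => e e0 N.
(* Dividing by n + 1 rather than n covers dimension 0 and keeps the final inequality strict. *)
have d0 : 0 < e / n.+1%:R by rewrite divr_gt0.
have [||v [[i Ni <-] vl]] := ul [set u i | i in [set i | (N <= i)%N]]
  (ball l (e / n.+1%:R)).
- by exists N => // i /= Ni; exists i.
- exact: nbhsx_ballx.
exists i => //.
rewrite enormB.
apply: (@le_lt_trans _ _ (n%:R * (e / n.+1%:R))).
  apply: enorm_le_coord; last exact: ltW.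
  move=> j; have [_ /(_ ord0 j)] := vl; rewrite /ball /= !mxE => /ltW; exact.
by rewrite mulrCA gtr_pMr// ltr_pdivrMr// mul1r ltr_nat.
Qed.

(** The form in which limits are taken below: an error linear in e. The bound e <= 1 lets callers
    absorb e * e into e or keep 1 - e nonnegative. *)
Lemma ler_addMeps (R : realType) (a b C : R) :
  (forall e, 0 < e -> e <= 1 -> a <= b + e * C) -> a <= b.
Proof.
move=> h; apply/ler_addgt0Pr => e e0.
have C0 : 0 < `|C| + 1 by rewrite ltr_wpDl.
have e1 : 0 < Num.min 1 (e / (`|C| + 1)) by rewrite lt_min ltr01 divr_gt0.
apply: (le_trans (h _ e1 _)); first by rewrite ge_min lexx.
rewrite lerD2l; apply: (@le_trans _ _ (Num.min 1 (e / (`|C| + 1)) * (`|C| + 1))).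
  by rewrite ler_pM2l// (le_trans (ler_norm C))// lerDl.
by rewrite -ler_pdivlMr// ge_min lexx orbT.
Qed.

Lemma invSn_le (R : realType) (e : R) : 0 < e ->
  exists N : nat, forall i, (N <= i)%N -> i.+1%:R^-1 <= e.
Proof.
move=> e0; have [k ke] := ltr_add_invr (e0).
exists k => i ki; rewrite add0r in ke; apply: le_trans (ltW ke).
by rewrite lef_pV2 ?posrE// ler_nat.
Qed.

(** * Distance to a set and projections *)

Lemma dist_has_lbound (R : realType) n (S : set 'rV[R]_n) x :
  has_lbound [set enorm (x - s) | s in S].
Proof. by exists 0 => _ [s _ <-]; exact: enorm_ge0. Qed.

Lemma dist_le (R : realType) n (S : set 'rV[R]_n) x s :
  S s -> dist S x <= enorm (s - x).
Proof.
by move=> Ss; rewrite enormB; apply: ge_inf; [exact: dist_has_lbound|exists s].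
Qed.

Lemma dist_adherent (R : realType) n (S : set 'rV[R]_n) x e :
  S !=set0 -> 0 < e -> exists2 s, S s & enorm (s - x) < dist S x + e.
Proof.
move=> [s0 Ss0] e0; have [|_ [s Ss <-] se] := @inf_adherent R
    [set enorm (x - s) | s in S] e e0.
  by split; [exists (enorm (x - s0)), s0|exact: dist_has_lbound].
by exists s => //; rewrite enormB.
Qed.

Lemma dist_lipschitz (R : realType) n (S : set 'rV[R]_n) x y :
  S !=set0 -> dist S y <= dist S x + enorm (y - x).
Proof.
move=> S0; apply/ler_addgt0Pr => e e0.
have [s Ss se] := dist_adherent x S0 e0.
apply: (le_trans (dist_le y Ss)).
have := enorm_triangle x s y; rewrite (enormB x y); lra.
Qed.

(** A minimizing sequence is bounded, so it has a cluster point, which is in S by closedness and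
    attains the distance. This yields both the existence of projections and the semicontinuity of
    rho. *)
Lemma proj_of_minimizing (R : realType) n (S : set 'rV[R]_n) x
    (u : nat -> 'rV[R]_n) :
  eclosed S -> (forall i, S (u i)) ->
  (forall i, enorm (u i - x) <= dist S x + i.+1%:R^-1) ->
  exists2 s, proj S x s & forall e, 0 < e -> exists i, enorm (u i - s) < e.
Proof.
move=> Scl Su ux.
have [|s us] := @bounded_enorm_cluster R n u (dist S x + 1 + enorm x).
  move=> i; have := enormD (u i - x) x; rewrite subrK => /le_trans; apply.
  rewrite lerD2r (le_trans (ux i))// lerD2l invf_le1// ler1n//.
have Ss : S s.
  by apply: Scl => e e0; have [i _ ie] := us e e0 0; exists (u i).
exists s; last by move=> e e0; have [i _ ie] := us e e0 0; exists i.
split => //; apply/eqP; rewrite eq_le dist_le// andbT.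
apply: (@ler_addMeps _ _ _ 2) => e e0 _.
have [N Ne] := invSn_le e0; have [i Ni ie] := us e e0 N.
have := enorm_triangle (u i) s x; rewrite (enormB s (u i)).
have := ux i; have := Ne i Ni; move: (_^-1) ie => k; lra.
Qed.

Lemma proj_nonempty (R : realType) n (S : set 'rV[R]_n) x :
  S !=set0 -> eclosed S -> proj S x !=set0.
Proof.
move=> S0 Scl.
have e0 i : 0 < i.+1%:R^-1 :> R by [].
have ex_u : forall i : nat, exists s,
    S s /\ enorm (s - x) <= dist S x + i.+1%:R^-1.
  by move=> i; have [s Ss /ltW] := dist_adherent x S0 (e0 i); exists s.
have [u ux] := boolp.choice ex_u.
have [s xs _] := proj_of_minimizing Scl (fun i => (ux i).1) (fun i => (ux i).2).
by exists s.
Qed.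

Lemma dist_gt0 (R : realType) n (S : set 'rV[R]_n) x :
  S !=set0 -> eclosed S -> ~ S x -> 0 < dist S x.
Proof.
move=> S0 Scl Sx; have [s [Ss <-]] := proj_nonempty x S0 Scl.
rewrite lt_def enorm_ge0 andbT; apply/eqP => /enorm_eq0/eqP.
by rewrite subr_eq0 => /eqP sx; rewrite -sx in Sx.
Qed.

Lemma subset_eclosure (R : realType) n (S : set 'rV[R]_n) : S `<=` eclosure S.
Proof.
by move=> x Sx e e0; exists x => //; rewrite subrr enorm0.
Qed.

Lemma subset_einterior (R : realType) n (S : set 'rV[R]_n) : einterior S `<=` S.
Proof.
move=> x [e e0]; apply.
by rewrite /oball /= subrr enorm0.
Qed.

(** From an interior point of S, a small step towards x would stay in S and come closer to x. *)
Lemma proj_bdry (R : realType) n (S : set 'rV[R]_n) x s :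
  ~ S x -> proj S x s -> bdry S s.
Proof.
move=> Sx [Ss sx]; split; first exact: subset_eclosure.
move=> [e e0 eS].
have xs0 : 0 < enorm (x - s).
  rewrite lt_def enorm_ge0 andbT; apply/eqP => /enorm_eq0/eqP.
  by rewrite subr_eq0 => /eqP xs; rewrite xs in Sx.
pose m := Num.min (e / 2) (enorm (x - s)) / enorm (x - s).
have m0 : 0 < m by rewrite divr_gt0// lt_min xs0 divr_gt0.
have m1 : m <= 1 by rewrite ler_pdivrMr// mul1r ge_min lexx orbT.
have : S (s + m *: (x - s)).
  apply: eS; rewrite /oball /= addrAC subrr add0r enormZ gtr0_norm//.
  by rewrite divfK ?gt_eqF// gt_min ltr_pdivrMr ?ltr_pMr// ltr1n.
move/(dist_le x); rewrite -sx (enormB s x).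
have -> : s + m *: (x - s) - x = (m - 1) *: (x - s).
  by apply/rowP => i; rewrite !mxE; ring.
apply/negP; rewrite -ltNge enormZ gtr_pMl// ltr_norml; lra.
Qed.

(** * Realization by a sphere as a quadratic inequality *)

Definition sphere_normal (R : realType) n (S : set 'rV[R]_n) s z (q : R) :=
  forall y, S y -> 2 * q * dotp z (y - s) <= dotp (y - s) (y - s).

(** Expanding the square of |y - s - q z| with |z| = 1 cancels q^2. Keeping the factor 2q on the
    left lets the inequality make sense at q = 0, where it is trivial. *)
Lemma realizedP (R : realType) n (S : set 'rV[R]_n) s z q :
  enorm z = 1 -> 0 < q -> realized S s z q <-> sphere_normal S s z q.
Proof.
move=> z1 q0.
have oballE y : oball (s + q *: z) q y <->
    dotp (y - s) (y - s) < 2 * q * dotp z (y - s).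
  rewrite /oball /= opprD addrA enorm_lt ?ltW//.
  move: (y - s) => w; rewrite !dotpE -(enorm_sqr z) z1 (dotpC w z).
  by split => h; lra.
split => [h y Sy|h].
  by rewrite leNgt; apply/negP => /oballE yb; rewrite -[False]/(set0 y) -h.
apply/seteqP; split => // y [/oballE + Sy].
by rewrite ltNge h.
Qed.

Lemma sphere_normal_le (R : realType) n (S : set 'rV[R]_n) s z p q :
  0 <= q <= p -> sphere_normal S s z p -> sphere_normal S s z q.
Proof.
move=> /andP[q0 qp] h y Sy.
have [zy|zy] := leP 0 (dotp z (y - s)).
  by apply: le_trans (h y Sy); rewrite ler_wpM2r// ler_pM2l.
by apply: le_trans (dotp_ge0 _); rewrite mulr_ge0_le0// ?mulr_ge0// ltW.
Qed.

Lemma realized_ext_sphere_normal (R : realType) n (S : set 'rV[R]_n) s z r q :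
  enorm z = 1 -> (0 < r)%E -> realized_ext S s z r ->
  0 <= q -> (q%:E <= r)%E -> sphere_normal S s z q.
Proof.
move=> z1; case: r => [p| |] //= p0 h q0 qp.
  by apply: (@sphere_normal_le _ _ _ _ _ p); [rewrite q0|apply/realizedP].
(* [realizedP] asks for a positive radius, while q may be 0. *)
have q1 : 0 < q + 1 by lra.
apply: (@sphere_normal_le _ _ _ _ _ (q + 1)); first lra.
by apply/realizedP => //; exact: h.
Qed.

(** * Sphere normals at a projection *)

Lemma einterior_open (R : realType) n (S : set 'rV[R]_n) x :
  einterior S x -> exists2 e, 0 < e & oball x e `<=` einterior S.
Proof.
move=> [e e0 eS]; have e2 : 0 < e / 2 by rewrite divr_gt0.
exists (e / 2) => // y yx; exists (e / 2) => // z zy.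
apply: eS; move: yx zy; rewrite /oball /=.
have := enorm_triangle y z x; lra.
Qed.

(** Take for tau the infimum of the parameters whose points are not interior; it is attained because
    the interior is open. *)
Lemma first_exit (R : realType) n (S : set 'rV[R]_n) a x :
  einterior S a -> ~ S x ->
  exists tau : R, [/\ 0 < tau <= 1, ~ einterior S (a + tau *: (x - a)) &
    forall l, 0 <= l < tau -> einterior S (a + l *: (x - a))].
Proof.
move=> Sa Sx.
pose A := [set l : R | 0 <= l <= 1 /\ ~ einterior S (a + l *: (x - a))].
have A1 : A 1.
  split; first by rewrite ler01 lexx.
  by rewrite scale1r addrC subrK => /subset_einterior.
have Alb : has_lbound A by exists 0 => l [/andP[]].
have tau_le l : A l -> inf A <= l by exact: ge_inf.
have tau0 : 0 <= inf A by apply: lb_le_inf; [exists 1|move=> l [/andP[]]].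
have Atau : ~ einterior S (a + inf A *: (x - a)).
  move=> /einterior_open[e e0 eS].
  have D0 : 0 < enorm (x - a) + 1 by rewrite ltr_wpDl ?enorm_ge0.
  have d0 : 0 < e / (enorm (x - a) + 1) by rewrite divr_gt0.
  have [|l Al] := @inf_adherent R A _ d0; first by split => //; exists 1.
  rewrite -ltrBlDl ltr_pdivlMr// => lt_l.
  have [_] := Al; apply; apply: eS; rewrite /oball /=.
  have -> : a + l *: (x - a) - (a + inf A *: (x - a)) = (l - inf A) *: (x - a).
    by apply/rowP => i; rewrite !mxE; ring.
  have l0 : 0 <= l - inf A by rewrite subr_ge0 tau_le.
  rewrite enormZ ger0_norm//; lra.
exists (inf A); split => //.
  rewrite (tau_le 1)// andbT lt_def tau0 andbT; apply/eqP => A0.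
  by apply: Atau; rewrite A0 scale0r addr0.
move=> l /andP[l0 lA]; apply: contrapT => nSl.
have /tau_le : A l by split => //; rewrite l0 (le_trans (ltW lA))// tau_le.
by rewrite leNgt lA.
Qed.

(* The segment from a point of the interior near s towards x leaves the
   interior at a point t, which is close to s because the open ball of centre x
   through s avoids S; the inner part of the segment forces the normal at t
   to point towards x. *)
Lemma normal_near_proj (R : realType) n (S : set 'rV[R]_n) r x s e :
  (forall s, bdry S s -> (0 < r s)%E) -> ext_ext_sphere S r ->
  ~ S x -> proj S x s -> bdry (einterior S) s -> 0 < e ->
  exists t z, [/\ bdry S t, enorm (t - s) <= 2 * e, enorm z = 1,
    - e <= dotp z (x - s) & realized_ext S t z (r t)].
Proof.
move=> r0 extS Sx [Ss sx] [sint _] e0.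
have [a Sa ae] := sint e e0.
have [tau [/andP[tau0 tau1] Stau Sl]] := first_exit Sa Sx.
set t := a + tau *: (x - a) in Stau.
have tl l : a + l *: (x - a) - t = (l - tau) *: (x - a).
  by apply/rowP => i; rewrite !mxE; ring.
have tint : eclosure (einterior S) t.
  move=> d d0.
  have D0 : 0 < enorm (x - a) + 1 by rewrite ltr_wpDl ?enorm_ge0.
  pose m := Num.min tau (d / (enorm (x - a) + 1)).
  have m0 : 0 < m by rewrite lt_min tau0 divr_gt0.
  have mtau : m <= tau by rewrite ge_min lexx.
  exists (a + (tau - m) *: (x - a)).
    by apply: Sl; rewrite subr_ge0 mtau ltrBlDr ltrDl.
  rewrite tl addrAC subrr add0r enormZ normrN gtr0_norm//.
  apply: (@lt_le_trans _ _ (m * (enorm (x - a) + 1))).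
    by rewrite ltr_pM2l// ltrDl.
  by rewrite -ler_pdivlMr// ge_min lexx orbT.
have St : bdry S t.
  split => // d d0; have [y /subset_einterior Sy yt] := tint d d0.
  by exists y.
have St' : bdry (einterior S) t by split => // /subset_einterior.
have [/(_ St')[z [z1 _ rz]] _] := extS t St.
have xt : x - t = (1 - tau) *: (x - a).
  by apply/rowP => i; rewrite !mxE; ring.
have ts : enorm (t - s) <= 2 * e.
  (* Since t is in the closure of S, |x - s| <= |x - t| = (1 - tau) |x - a|. Hence tau |x - a| <= |x
     - a| - |x - s| <= |a - s|. *)
  have at_le : enorm (t - a) <= e.
    have -> : t - a = tau *: (x - a) by rewrite /t addrAC subrr add0r.
    rewrite enormZ gtr0_norm//.
    have : dist S x <= enorm (x - t).
      apply/ler_addgt0Pr => d d0.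
      have [y /subset_einterior Sy yt] := tint d d0.
      have := dist_le x Sy; have := enorm_triangle t y x.
      rewrite (enormB x t); lra.
    rewrite xt enormZ ger0_norm ?subr_ge0// -sx.
    have := enorm_triangle s a x; rewrite (enormB x a); lra.
  have := enorm_triangle a t s; lra.
have [q q0 zq] : exists2 q, 0 < q & sphere_normal S t z q.
  have : forall q, 0 <= q -> (q%:E <= r t)%E -> sphere_normal S t z q.
    by move=> q; apply: realized_ext_sphere_normal => //; exact: r0.
  case: (r t) (r0 t St) => [p| |] //.
    by rewrite lte_fin => p0 /(_ p (ltW p0) (lexx _)); exists p.
  by move=> _ /(_ 1 ler01 (leey _)); exists 1.
have zxa : 0 <= dotp z (x - a).
  suff : 0 <= 2 * q * dotp z (x - a) by rewrite pmulr_rge0// mulr_gt0.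
  (* Test the sphere inequality at the point of parameter tau (1 - d), which is in S, divide by tau
     d and let d tend to 0. *)
  apply: (@ler_addMeps _ _ _ (tau * dotp (x - a) (x - a))) => d d0 d1.
  have := zq (a + (tau * (1 - d)) *: (x - a)).
  rewrite tl !dotpZl !dotpZr => h.
  have {}h : 2 * q * ((tau * (1 - d) - tau) * dotp z (x - a)) <=
     (tau * (1 - d) - tau) * ((tau * (1 - d) - tau) * dotp (x - a) (x - a)).
    apply: h; apply: subset_einterior; apply: Sl.
    by rewrite mulr_ge0 ?subr_ge0 ?(ltW tau0)//= gtr_pMr// ltrBlDr ltrDl.
  rewrite -(ler_pM2l (mulr_gt0 tau0 d0)); lra.
exists t, z; split => //.
have := dotp_le_enorm z (s - a); rewrite z1 mul1r (enormB s a).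
have -> : x - s = (x - a) - (s - a) by rewrite opprB addrA subrK.
rewrite (dotpDr (x - a)) dotpNr; lra.
Qed.

(** For fixed q and y the inequality is continuous in the base point and the normal. *)
Lemma sphere_normal_lim (R : realType) n (S : set 'rV[R]_n) s z q :
  enorm z = 1 -> 0 <= q ->
  (forall e, 0 < e -> exists t w, [/\ enorm (t - s) <= e, enorm (w - z) <= e &
     sphere_normal S t w q]) -> sphere_normal S s z q.
Proof.
move=> z1 q0 lim y Sy.
pose D := enorm (y - s).
(* As e <= 1, the right side moves by at most (D + e)^2 - D^2 <= e (2D + 1), and the left side by at
   most 2q (e + e (D + e)) <= 2q e (D + 2). *)
apply: (@ler_addMeps _ _ _ (2 * D + 1 + 2 * q * (D + 2))) => e e0 e1.
have [t [w [ts wz /(_ y Sy)]]] := lim e e0.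
have -> : dotp w (y - t) = dotp z (y - s) - dotp z (t - s) + dotp (w - z) (y - t).
  by rewrite !dotpE; ring.
have yt : enorm (y - t) <= D + e.
  have := enorm_triangle s y t; rewrite (enormB s t) -/D; lra.
have zt : dotp z (t - s) <= e.
  by have := dotp_le_enorm z (t - s); rewrite z1; lra.
have wt : - (e * (D + e)) <= dotp (w - z) (y - t).
  rewrite lerNl -dotpNl; apply: (le_trans (dotp_le_enorm _ _)).
  by rewrite enormN ler_pM ?enorm_ge0.
have : enorm (y - t) ^+ 2 <= (D + e) ^+ 2.
  by rewrite ler_sqr ?nnegrE ?(le_trans (enorm_ge0 _) yt)// enorm_ge0.
rewrite -!enorm_sqr -/D => h1 h2.
have D0 : 0 <= D by exact: enorm_ge0.
have e2 : e * e <= e by rewrite ger_pMr.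
have : 2 * q * (- e + - (e * (D + e))) <=
  2 * q * (- dotp z (t - s) + dotp (w - z) (y - t)).
  by rewrite ler_wpM2l ?mulr_ge0//; lra.
have : 2 * q * (e * e) <= 2 * q * e by rewrite ler_wpM2l ?mulr_ge0.
lra.
Qed.

Lemma hemisphere_normal (R : realType) n (S : set 'rV[R]_n) r x s :
  (forall s, bdry S s -> (0 < r s)%E) -> econt_on (bdry S) r ->
  ext_ext_sphere S r -> ~ S x -> proj S x s ->
  exists z, [/\ enorm z = 1, 0 <= dotp z (x - s) &
    forall q, 0 <= q -> (q%:E <= r s)%E -> sphere_normal S s z q].
Proof.
move=> r0 rcont extS Sx xs.
have sb := proj_bdry Sx xs.
have [sint|nsint] := pselect (bdry (einterior S) s); last first.
  have xs0 : 0 < enorm (x - s).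
    rewrite lt_def enorm_ge0 andbT; apply/eqP => /enorm_eq0/eqP.
    by rewrite subr_eq0 => /eqP xs'; move: Sx; rewrite xs'; apply; case: xs.
  pose z := (enorm (x - s))^-1 *: (x - s).
  have z1 : enorm z = 1.
    by rewrite enormZ ger0_norm ?invr_ge0 ?enorm_ge0// mulVf ?gt_eqF.
  exists z; split => //; first by rewrite dotpZl mulr_ge0 ?dotp_ge0// invr_ge0 ltW.
  move=> q q0 qr; apply: (realized_ext_sphere_normal z1 (r0 _ sb) _ q0 qr).
  (* Expanding |y - x| >= |x - s| gives 2 <x - s, y - s> <= |y - s|^2; dividing by 2 |x - s| gives
     this constant. *)
  apply: (extS s sb).2 => //; exists (2 * enorm (x - s))^-1.
    by rewrite invr_ge0 mulr_ge0// ltW.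
  move=> y Sy; rewrite dotpZl invfM -mulrA [leRHS]mulrCA.
  rewrite ler_pM2l ?invr_gt0//.
  have [_ sx] := xs; have := dist_le x Sy; rewrite -sx (enormB s x).
  have -> : y - x = (y - s) - (x - s) by rewrite opprB addrA subrK.
  move: (x - s) (y - s) => u v; rewrite enorm_le ?enorm_ge0//.
  rewrite !enorm_sqr !dotpE (dotpC v u); lra.
have e0 i : 0 < i.+1%:R^-1 :> R by [].
have h i := normal_near_proj r0 extS Sx xs sint (e0 i).
have [t {}h] := boolp.choice h; have [w {}h] := boolp.choice h.
have w1 i : enorm (w i) = 1 by case: (h i).
have [|z wz] := @bounded_enorm_cluster R n w 1; first by move=> i; rewrite w1.
have {}wz e : 0 < e -> exists i, [/\ enorm (w i - z) <= e,
    enorm (t i - s) <= e & - e <= dotp (w i) (x - s)].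
  (* The half offsets the factor 2 in the bound on t in [normal_near_proj]. *)
  move=> e0'; have [|N Ne] := @invSn_le R (e / 2); first by rewrite divr_gt0.
  have [i Ni we] := wz e e0' N; exists i; have [_ ts _ ws _] := h i.
  have := Ne i Ni; move: (_^-1) ts ws => k ts ws ke.
  by split; lra.
have z1 : enorm z = 1.
  apply/eqP; rewrite eq_le; apply/andP; split;
    apply: (@ler_addMeps _ _ _ 1) => e {}e0 _; have [i [we _ _]] := wz e e0.
    have := enormD (w i) (z - w i); rewrite addrC subrK w1 (enormB z); lra.
  have := enormD z (w i - z); rewrite addrC subrK w1; lra.
exists z; split => //.
  apply: (@ler_addMeps _ _ _ (1 + enorm (x - s))) => e {}e0 _.
  have [i [we _ ws]] := wz e e0.
  have := dotp_le_enorm (w i - z) (x - s); rewrite dotpDl dotpNl.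
  have := ler_wpM2r (enorm_ge0 (x - s)) we; lra.
(* By continuity of r, a radius q < r(s) stays below r(t i) once t i is near s, so the limit is
   taken at fixed q. The endpoint q = r(s) follows from q (1 - e) as e tends to 0. *)
have lt_r q : 0 <= q -> (q%:E < r s)%E -> sphere_normal S s z q.
  move=> q0 qr; apply: sphere_normal_lim => // e {}e0.
  have [rl _] := rcont s sb; have [d d0 dr] := rl q qr.
  have [|i [we ts _]] := wz (Num.min e (d / 2)).
    by rewrite lt_min e0 divr_gt0.
  move: we ts; rewrite !le_min => /andP[we _] /andP[te td].
  exists (t i), (w i); split => //; have [bt _ _ _ rw] := h i.
  apply: (realized_ext_sphere_normal (w1 i) (r0 _ bt) rw q0).
  by apply/ltW/dr => //; lra.
move=> q q0; rewrite le_eqVlt => /orP[/eqP qr|]; last exact: lt_r.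
have {}q0 : 0 < q by rewrite -lte_fin qr r0.
move=> y Sy.
apply: (@ler_addMeps _ _ _ (2 * q * dotp z (y - s))) => e {}e0 e1.
have := lt_r (q * (1 - e)) _ _ y Sy; rewrite -qr lte_fin gtr_pMr//.
rewrite mulr_ge0 ?subr_ge0 ?(ltW q0)// ltrBlDr ltrDl => /(_ isT e0); lra.
Qed.

(** * The radius as a function of a = gamma d and p = rho, and its lower semicontinuity *)

Definition radius (R : realType) (a p : R) : R :=
  Num.max a (2^-1 * Num.sqrt (a ^+ 2 + 4 * p ^+ 2)).

Lemma radiusM (R : realType) (k a p : R) : 0 <= k ->
  radius (k * a) (k * p) = k * radius a p.
Proof.
move=> k0; rewrite /radius maxr_pMr//; congr Num.max.
have -> : (k * a) ^+ 2 + 4 * (k * p) ^+ 2 = k ^+ 2 * (a ^+ 2 + 4 * p ^+ 2).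
  by ring.
rewrite sqrtrM ?sqr_ge0// sqrtr_sqr ger0_norm//.
by rewrite mulrCA.
Qed.

Lemma le_radius (R : realType) (a b p q : R) :
  0 <= a <= b -> 0 <= p <= q -> radius a p <= radius b q.
Proof.
move=> /andP[a0 ab] /andP[p0 pq]; rewrite /radius ge_max !le_max ab /=.
apply/orP; right; rewrite ler_pM2l ?invr_gt0// ler_wsqrtr// lerD//.
  by rewrite ler_sqr ?nnegrE// (le_trans a0).
by rewrite ler_pM2l// ler_sqr ?nnegrE// (le_trans p0).
Qed.

Lemma radius_ge (R : realType) (a p : R) : 0 <= p -> p <= radius a p.
Proof.
move=> p0; rewrite /radius le_max; apply/orP; right.
rewrite ler_pdivlMl// -[2 * p]ger0_norm ?mulr_ge0// -sqrtr_sqr.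
by rewrite ler_wsqrtr// exprMn -natrX lerDr sqr_ge0.
Qed.

Lemma lte_half (R : realType) (t : R) (a : \bar R) :
  (t%:E < a * (2^-1)%:E)%E = ((2 * t)%:E < a)%E.
Proof.
have h : (0 < (2^-1)%:E :> \bar R)%E by rewrite lte_fin invr_gt0.
case: a => [a| |]; last 2 first.
- by rewrite gt0_mulye// !ltry.
- by rewrite gt0_mulNye// !ltNge !leNye.
by rewrite -EFinM !lte_fin ltr_pdivlMr// mulrC.
Qed.

Lemma rho_fun_le (R : realType) n (S : set 'rV[R]_n) r x s (p : R) :
  proj S x s -> (p%:E <= rho_fun S r x)%E -> ((2 * p)%:E <= r s)%E.
Proof.
move=> xs px; rewrite leNgt; apply/negP => rs.
have : (p%:E <= r s * (2^-1)%:E)%E.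
  by apply: le_trans px _; apply: ereal_inf_lbound; exists s.
case: (r s) rs => [a| |] //.
  by rewrite -EFinM lte_fin lee_fin ler_pdivlMr//; lra.
by rewrite gt0_mulNye ?lte_fin ?invr_gt0.
Qed.

Lemma rho_fun_ge0 (R : realType) n (S : set 'rV[R]_n) r x :
  (forall s, bdry S s -> (0 < r s)%E) -> ~ S x -> (0 <= rho_fun S r x)%E.
Proof.
move=> r0 Sx; apply: le_ereal_inf_tmp => _ [s xs <-].
by rewrite mule_ge0 ?lee_fin ?invr_ge0// ltW// r0//; exact: proj_bdry xs.
Qed.

(** Otherwise points tending to x have projections with r < 2t. These form a minimizing sequence for
    x, so they come arbitrarily close to a projection of x, where r > 2t, against continuity of r.
    The inequality passes through an infimum, hence is weak; [varrho_lsc] restores strictness. *)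
Lemma rho_fun_lsc (R : realType) n (S : set 'rV[R]_n) r x (t : R) :
  S !=set0 -> eclosed S -> econt_on (bdry S) r -> ~ S x ->
  (t%:E < rho_fun S r x)%E ->
  exists2 d, 0 < d & forall y, ~ S y -> enorm (y - x) < d ->
    (t%:E <= rho_fun S r y)%E.
Proof.
move=> S0 Scl rcont Sx tx; apply: contrapT => nh.
have h (i : nat) : exists s, [/\ bdry S s, S s,
    enorm (s - x) <= dist S x + i.+1%:R^-1 & (r s < (2 * t)%:E)%E].
  (* The half is needed because |s - x| <= d(y) + |y - x| <= d(x) + 2 |y - x| for a projection s of
     y. *)
  apply: contrapT => ns; apply: nh; exists (i.+1%:R^-1 / 2) => [|y Sy yx].
    by rewrite divr_gt0// invr_gt0.
  apply: le_ereal_inf_tmp => _ [s ys <-]; rewrite leNgt; apply/negP => st.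
  apply: ns; exists s; have [Ss sy] := ys; split => //.
  - exact: proj_bdry ys.
  - have := dist_lipschitz x y S0; have := enorm_triangle y s x.
    rewrite sy; move: (_^-1) yx => k; lra.
  - case: (r s) st => [a| |] //; last by rewrite ltNyr.
      by rewrite -EFinM !lte_fin ltr_pdivrMr// mulrC.
    by rewrite gt0_mulye// lte_fin invr_gt0.
have [u {}h] := boolp.choice h.
have [||s xs us] := @proj_of_minimizing _ _ S x u Scl.
- by move=> i; case: (h i).
- by move=> i; case: (h i).
have ts : ((2 * t)%:E < r s)%E.
  rewrite -lte_half; apply: lt_le_trans tx _.
  by apply: ereal_inf_lbound; exists s.
have [/(_ _ ts)[d d0 ds] _] := rcont s (proj_bdry Sx xs).
have [i id] := us d d0; have [ub _ _] := h i.
by rewrite ltNge ltW// ds.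
Qed.

Lemma varrhoE (R : realType) n (S : set 'rV[R]_n) r g x (p : R) :
  rho_fun S r x = p%:E -> varrho S r g x = (radius (g * dist S x) p)%:E.
Proof. by rewrite /varrho => ->; rewrite /radius exprMn. Qed.

(** If rho(x) is finite, pick k < 1 such that k times the radius at x still exceeds t. Near x, the
    distance and rho are at least k times their values at x, and homogeneity and monotonicity of
    [radius] conclude. *)
Lemma varrho_lsc (R : realType) n (S : set 'rV[R]_n) r g :
  S !=set0 -> eclosed S -> (forall s, bdry S s -> (0 < r s)%E) ->
  econt_on (bdry S) r -> 0 <= g -> elsc_on (~` S) (varrho S r g).
Proof.
move=> S0 Scl r0 rcont g0 x Sx t tx.
have dx := dist_gt0 S0 Scl Sx.
have ge_rad a p y : ~ S y -> 0 <= a <= dist S y -> 0 <= p ->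
    (p%:E <= rho_fun S r y)%E -> ((radius (g * a) p)%:E <= varrho S r g y)%E.
  move=> Sy /andP[a0 ay] p0; case E : (rho_fun S r y) => [q| |]; last 2 first.
  - by move=> _; rewrite /varrho E leey.
  - by rewrite leeNy_eq.
  rewrite (varrhoE _ E) !lee_fin => pq.
  by apply: le_radius; rewrite ?p0// mulr_ge0//= ler_wpM2l.
case E : (rho_fun S r x) => [p| |]; last first.
- by have := rho_fun_ge0 r0 Sx; rewrite E.
(* Here rho(x) is infinite: rho is at least |t| + 1 near x, and the radius is at least rho. *)
- have [d d0 dr] := @rho_fun_lsc _ _ S r x (`|t| + 1) S0 Scl rcont Sx
    (eq_ind_r (fun a => (_ < a)%E) (ltry _) E).
  exists d => // y Sy yx.
  have p0 : 0 <= `|t| + 1 by rewrite addr_ge0.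
  have dy := dist_gt0 S0 Scl Sy.
  apply: lt_le_trans (ge_rad 0 _ y Sy _ p0 (dr _ Sy yx)); last first.
    by rewrite lexx ltW.
  rewrite lte_fin; apply: lt_le_trans (radius_ge _ p0).
  by have := ler_norm t; lra.
rewrite (varrhoE _ E) lte_fin in tx.
have p0 : 0 <= p by rewrite -lee_fin -E; exact: rho_fun_ge0.
have [k /andP[k0 k1] tk] : exists2 k, 0 <= k < 1 & t < k * radius (g * dist S x) p.
  have [t0|t0] := ltP t 0; first by exists 0; [rewrite lexx ltr01|rewrite mul0r].
  set q := radius _ _ in tx *.
  have q0 : 0 < q by exact: le_lt_trans tx.
  (* The midpoint of t / q and 1, so that k q is the midpoint of t and q. *)
  exists ((t / q + 1) / 2).
    have : t / q < 1 by rewrite ltr_pdivrMr// mul1r.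
    have : 0 <= t / q by rewrite divr_ge0// ltW.
    move: (t / q) => a; lra.
  have -> : (t / q + 1) / 2 * q = (t + q) / 2 by field; rewrite gt_eqF.
  lra.
rewrite -radiusM// mulrCA in tk.
have [d1 d10 dr] : exists2 d, 0 < d & forall y, ~ S y -> enorm (y - x) < d ->
    ((k * p)%:E <= rho_fun S r y)%E.
  (* For p = 0 there is no strict inequality k p < p to feed to [rho_fun_lsc]; nonnegativity of rho
     replaces it. *)
  have [p1|] := ltP 0 p; last first.
    move=> p1; exists 1 => // y Sy _.
    have -> : p = 0 by apply/eqP; rewrite eq_le p1.
    by rewrite mulr0; exact: rho_fun_ge0.
  by apply: rho_fun_lsc => //; rewrite E lte_fin gtr_pMl.
exists (Num.min d1 ((1 - k) * dist S x)).
  by rewrite lt_min d10 mulr_gt0// subr_gt0.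
move=> y Sy; rewrite lt_min => /andP[y1 y2].
apply: lt_le_trans (ge_rad (k * dist S x) _ y Sy _ _ (dr _ Sy y1)).
- by rewrite lte_fin.
- rewrite mulr_ge0 ?(ltW dx)//=.
  have := dist_lipschitz y x S0; rewrite (enormB x y); lra.
- exact: mulr_ge0.
Qed.

(** * Closed balls in the complement *)

(* The centre lies on the segment from x to s + 2pz, whose points centre balls
   that avoid S and have s on their boundary; the weight b makes the distance from
   the centre to x at most the required radius, with equality if z is orthogonal
   to x - s. *)
Lemma closed_ball_finite_radius (R : realType) n (S : set 'rV[R]_n) x s z g p :
  S !=set0 -> eclosed S -> ~ S x -> proj S x s -> 0 <= g < 1 -> 0 <= p ->
  enorm z = 1 -> 0 <= dotp z (x - s) -> sphere_normal S s z (2 * p) ->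
  exists y, cball y (radius (g * dist S x) p) x /\
    cball y (radius (g * dist S x) p) `<=` ~` S.
Proof.
move=> S0 Scl Sx [Ss sx] /andP[g0 g1] p0 z1 zx zS.
have d0 := dist_gt0 S0 Scl Sx.
rewrite /radius; set d := dist S x in d0 sx *; set q := 2^-1 * _.
have [qg|gq] := leP q (g * d).
  (* The radius is g d < d, so the ball centred at x itself avoids S. *)
  exists x; split.
    by rewrite /cball /= subrr enorm0 mulr_ge0// ltW.
  move=> y; rewrite /cball /= => yx /(dist_le x); rewrite -/d.
  have : g * d < d by rewrite gtr_pMl.
  lra.
have q0 : 0 < q by apply: le_lt_trans gq; rewrite mulr_ge0// ltW.
have qq : q ^+ 2 = (g ^+ 2 * d ^+ 2) / 4 + p ^+ 2.
  rewrite exprMn sqr_sqrtr; first by rewrite exprMn; field.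
  by rewrite addr_ge0 ?sqr_ge0// mulr_ge0 ?sqr_ge0.
(* D is the distance from x to s + 2pz when z is orthogonal to x - s, and bounds it from above since
   <z, x - s> >= 0. From g < 1 follows 2q < D, hence b = q / D < 1/2. *)
pose D := Num.sqrt (d ^+ 2 + 4 * p ^+ 2).
have DD : D ^+ 2 = d ^+ 2 + 4 * p ^+ 2.
  by rewrite sqr_sqrtr// addr_ge0 ?sqr_ge0// mulr_ge0 ?sqr_ge0.
have D0 : 0 < D.
  by rewrite sqrtr_gt0 ltr_pwDl ?exprn_gt0// mulr_ge0 ?sqr_ge0.
have dd0 : 0 < d ^+ 2 by exact: exprn_gt0.
have q2D : 2 * q < D.
  rewrite -ltr_sqr; [|by rewrite nnegrE mulr_ge0// ltW|by rewrite nnegrE ltW].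
  rewrite DD; have -> : (2 * q) ^+ 2 = 4 * q ^+ 2 by ring.
  rewrite qq.
  have : g ^+ 2 * d ^+ 2 < d ^+ 2 by rewrite gtr_pMl// exprn_ilt1.
  lra.
pose b := q / D.
have b0 : 0 < b by rewrite divr_gt0.
have b1 : 2 * b < 1 by rewrite mulrA ltr_pdivrMr// mul1r.
have bD : b ^+ 2 * (d ^+ 2 + 4 * p ^+ 2) = q ^+ 2.
  by rewrite -DD -exprMn divfK ?gt_eqF.
have uu : dotp (x - s) (x - s) = d ^+ 2 by rewrite -enorm_sqr enormB sx.
have zz : dotp z z = 1 by rewrite -enorm_sqr z1 expr1n.
have dist_x y : S y -> 2 * dotp (x - s) (y - s) <= dotp (y - s) (y - s).
  move=> /(dist_le x); rewrite -/d.
  have -> : y - x = (y - s) - (x - s) by rewrite opprB addrA subrK.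
  rewrite -sx (enormB s x) enorm_le ?enorm_ge0// enorm_sqr.
  move: (x - s) (y - s) => u v; rewrite !dotpE (dotpC v u); lra.
pose c := s + ((1 - b) *: (x - s) + (b * (2 * p)) *: z).
have pzx : 0 <= b * p * dotp z (x - s) by rewrite mulr_ge0// mulr_ge0// ltW.
exists c; split.
  rewrite /cball /= enorm_le ?(ltW q0)// -bD.
  have -> : x - c = b *: (x - s) - (b * (2 * p)) *: z.
    by apply/rowP => i; rewrite !mxE; ring.
  have := mulr_ge0 (ltW b0) pzx.
  move: (x - s) uu => u uu; rewrite !dotpE uu zz (dotpC u z); lra.
move=> y yc Sy; move: yc; rewrite /cball /= enorm_le ?(ltW q0)//; apply/negP.
rewrite -ltNge.
have -> : y - c = (y - s) - ((1 - b) *: (x - s) + (b * (2 * p)) *: z).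
  by rewrite /c opprD addrA.
have b1' : 0 <= 1 - b by lra.
(* Weighting by 1 - b and b the inequalities for the balls centred at x and s + 2pz gives |y - c| >=
   |c - s|. Moreover |c - s|^2 >= (1 - b)^2 d^2 + 4 b^2 p^2 = q^2 + (1 - 2b) d^2 > q^2. *)
have := ler_wpM2l b1' (dist_x y Sy).
have := ler_wpM2l (ltW b0) (zS y Sy).
have := mulr_ge0 b1' pzx.
have : 0 < (1 - 2 * b) * d ^+ 2 by rewrite mulr_gt0// subr_gt0.
move: (x - s) (y - s) uu bD => u v uu bD.
rewrite !dotpE uu zz (dotpC u z) (dotpC v u) (dotpC v z); lra.
Qed.

Theorem theorem2 (R : realType) (n : nat) (S : set 'rV[R]_n)
  (r : 'rV[R]_n -> \bar R) :
  S !=set0 -> eclosed S ->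
  (forall s, bdry S s -> (0%:E < r s)%E) ->
  econt_on (bdry S) r ->
  ext_ext_sphere S r ->
  forall gamma : R,
    (2 * Num.sqrt 3 - 2)^-1 <= gamma -> gamma < 1 ->
    elsc_on (~` S) (varrho S r gamma) /\
    union_closed_balls (~` S) (varrho S r gamma).
Proof.
move=> S0 Scl r0 rcont extS g g_ge g1.
have g0 : 0 <= g.
  apply: le_trans g_ge; rewrite invr_ge0 subr_ge0 ler_pMr// -{1}sqrtr1.
  by rewrite ler_wsqrtr// ler1n.
split; first exact: varrho_lsc.
move=> x Sx; have [s xs] := proj_nonempty x S0 Scl.
have [z [z1 zx zS]] := hemisphere_normal r0 rcont extS Sx xs.
case E : (rho_fun S r x) => [p| |]; last first.
- by have := rho_fun_ge0 r0 Sx; rewrite E.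
- have zy y : S y -> dotp z (y - s) <= 0.
    move=> Sy; rewrite leNgt; apply/negP => zy.
    have ry q : 0 <= q -> 2 * q * dotp z (y - s) <= dotp (y - s) (y - s).
      move=> q0; apply: zS => //.
      apply: le_trans (_ : ((2 * q)%:E <= _)%E); first by rewrite lee_fin; lra.
      by apply: rho_fun_le xs _; rewrite E leey.
    (* With this q the sphere inequality would read 2 (|y - s|^2 + 1) <= |y - s|^2. *)
    have k0 : 0 <= (dotp (y - s) (y - s) + 1) / dotp z (y - s).
      by rewrite divr_ge0 ?addr_ge0 ?dotp_ge0// ltW.
    have := ry _ k0; rewrite -mulrA divfK ?gt_eqF//.
    have := dotp_ge0 (y - s); lra.
  (* For w = y - x, membership in the ball means |w|^2 <= 2d <z, w>, while y in S gives <z, w> <= -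
     <z, x - s> <= 0. So y = x, which is not in S. *)
  have far y d : 0 < d -> cball (x + d *: z) d y -> ~ S y.
    move=> d0; rewrite /cball /= enorm_le ?(ltW d0)//.
    have -> : y - (x + d *: z) = (y - x) - d *: z by rewrite opprD addrA.
    move=> yx Sy; have := zy y Sy.
    have -> : y - s = (y - x) + (x - s) by rewrite addrA subrK.
    rewrite dotpDr => zyx.
    suff /eqP : y - x = 0 by rewrite subr_eq0 => /eqP yx0; rewrite -yx0 in Sx.
    apply/enorm_eq0/eqP; rewrite eq_le enorm_ge0 andbT enorm_le// expr0n /=.
    have dz : d * dotp z (y - x) <= 0 by rewrite pmulr_rle0//; lra.
    move: (y - x) yx dz {zyx} => w.
    rewrite !dotpE -(enorm_sqr z) z1 (dotpC w z); lra.
  have xz d : 0 < d -> cball (x + d *: z) d x.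
    move=> d0; rewrite /cball /= opprD addrA subrr add0r enormN enormZ z1.
    by rewrite mulr1 gtr0_norm.
  exists (x + z).
    apply: (far _ 1) => //; rewrite /cball /= scale1r subrr.
    by rewrite enorm0.
  rewrite /varrho E; split => // _ d d0.
  rewrite [x + z]addrC addrK; split; first exact: xz.
  by move=> y; exact: far.
have p0 : 0 <= p by rewrite -lee_fin -E; exact: rho_fun_ge0.
have zp : sphere_normal S s z (2 * p).
  by apply: zS; [exact: mulr_ge0|apply: rho_fun_le xs _; rewrite E].
have g01 : 0 <= g < 1 by rewrite g0.
have [y [yx yS]] := closed_ball_finite_radius S0 Scl Sx xs g01 p0 z1 zx zp.
exists y; last by rewrite (varrhoE _ E); split => // q [<-].
(* The centre lies in its own ball, the radius being nonnegative. *)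
apply: yS; rewrite /cball /= subrr enorm0.
exact: le_trans p0 (radius_ge _ p0).
Qed.
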